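(* Let $\delta>0$, $h=h(\delta)>0$, $\tau>0$, and let the Structural Assumptions (A1)–(A8) listed in the context hold. Let $m_{(\mathrm I)}$ and $m_{(\mathrm{McC}_{\delta\tau})}$ be the optimal objective values of the problems $(\mathrm I)$ and $(\mathrm{McC}_{\delta\tau})$ defined in the context. Then $$m_{(\mathrm I)}\ \ge\ m_{(\mathrm{McC}_{\delta\tau})}-\Bigl(\inf\bigl\{\|Tu-Tu_{\delta\tau}\|_Y:\ (u,w)\in\arg\min(\mathrm I),\ u_{\delta\tau}\text{ solves }Au_{\delta\tau}+f_0(P_\tau u_{\delta\tau})(P_\tau P_{h(\delta)}w)=f_1\bigr\}+\delta\Bigr).$$
   Context: Setting. $\Omega\subset\mathbb{R}^d$, $d\in\mathbb{N}$, is a bounded Lipschitz domain; $U$ is a Banach space continuously embedded in $L^2(\Omega)$; $A:U\to L^2(\Omega)$ is a linear isomorphism; $T:L^2(\Omega)\to Y$ is a bounded linear observation operator into a Banach space $Y$; $f_0\in L^\infty(\Omega)$, $f_0\ge0$; $f_1\in L^2(\Omega)$. $w_\ell,w_u\in L^\infty(\Omega)$ are given, and $W^{\mathrm{ad}}$ is a nonempty subset of $\{w\in L^\infty(\Omega): w_\ell\le w\le w_u \text{ a.e. in }\Omega\}$. $y^\dagger\in Y$ are exact data and $y^\delta\in Y$ noisy data with $\|y^\dagger-y^\delta\|_Y\le\delta$. Meshes and projections. $\mathcal{Q}_h=\{Q_h^1,\dots,Q_h^{N_h}\}$ and $\mathcal{Q}_\tau=\{Q_\tau^1,\dots,Q_\tau^{N_\tau}\}$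 are finite partitions of $\Omega$ with mesh sizes $h$ and $\tau$. $V_h$ is the discretization set for $w$, defined on $\mathcal{Q}_h$, and $W^{\mathrm{ad}}_h=W^{\mathrm{ad}}\cap V_h$. $P_{V_h}=P_h$ and $P_{W_h^{\mathrm{ad}}}$ are the $L^2(\Omega)$-metric projections onto $V_h$ and $W^{\mathrm{ad}}_h$. $P_\tau$ is local averaging: $(P_\tau v)|_{Q_\tau^i}=|Q_\tau^i|^{-1}\int_{Q_\tau^i}v\,dx$. State equations: (E) $Au+f_0uw=f_1$; (E$_\tau$) $Au+f_0(P_\tau u)(P_\tau w)=f_1$. Problems. $(\mathrm I)$: minimize $\|Tu-y^\dagger\|_Y$ over $(u,w)$, $u\in U$, subject to $Au+f_0uw=f_1$, $w\in W^{\mathrm{ad}}$. $(\mathrm{McC}_{\delta\tau})$: minimize $\|Tu-y^\delta\|_Y$ over $(u,w,z)$, $u\in U$, subject to $Au+f_0z=f_1$, $w\in\mathrm{conv}\,W^{\mathrm{ad}}_h$, $z\in Z^{\mathrm{ad}}_\tau$, and, for all $i\in\{1,\dots,N_\tau\}$, a.e. in $Q_\tau^i$, with $z_i$ the constant value of $z$ on $Q^i_\tau$ and $u_\ell^i,u_u^i,w_\ell^i,w_u^i$ from (A4), (A5): $u^i_\ell P_\tau w+w^i_\ell P_\tau u-u^i_\ell w^i_\ell-z_i\le0$, $\ u^i_uP_\tau w+w^i_uP_\tau u-u^i_uw^i_u-z_i\le0$, $\ z_i-u^i_uP_\tau w-w^i_\ell P_\tau u+u^i_uw^i_\ell\le0$,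 $\ z_i-u^i_\ell P_\tau w-w^i_uP_\tau u+u^i_\ell w^i_u\le0$. Structural Assumptions. (A1) $V_h$ is a closed convex subset of a finite-dimensional ansatz space for $L^2(\Omega)$. (A2) For all $w\in W^{\mathrm{ad}}$, (E) and (E$_\tau$) admit unique solutions in $U$. (A3) There are $u_\ell,u_u\in L^\infty(\Omega)$ such that for all $w\in W^{\mathrm{ad}}$ the solution $u$ of (E) satisfies $u_\ell\le u\le u_u$ a.e. in $\Omega$. (A4) There are $u_\ell^i,u_u^i\in\mathbb{R}$ such that for all $w\in W^{\mathrm{ad}}$ the solution $u$ of (E$_\tau$) satisfies $u_\ell^i\le P_\tau u\le u_u^i$ a.e. in $Q_\tau^i$, $i=1,\dots,N_\tau$. (A5) There are $w_\ell^i,w_u^i\in\mathbb{R}$ such that for all $w\in W^{\mathrm{ad}}_h$, $w_\ell^i\le P_\tau w\le w_u^i$ a.e. in $Q_\tau^i$, $i=1,\dots,N_\tau$. (A6) $P_{V_h}w=P_{W^{\mathrm{ad}}_h}w$ for all $w\in W^{\mathrm{ad}}$. (A7) $Z^{\mathrm{ad}}$ is a closed, convex, bounded subset of $L^\infty(\Omega)$, and $uw\in Z^{\mathrm{ad}}$ whenever $u$ solves (E) for $w\in W^{\mathrm{ad}}_h$. (A8) $Z^{\mathrm{ad}}_\tau$ is a closed, convex, bounded subset of $L^\infty(\Omega)$ consisting of piecewise constant functions on $\mathcal{Q}_\tau$, and $(P_\tau u)(P_\tau w)\in Z^{\mathrm{ad}}_\tau$ whenever $u$ solves (E$_\tau$)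 for $w\in W^{\mathrm{ad}}_h$. *)

(* Defs.v *)
From HB Require Import structures.
From mathcomp Require Import all_boot all_order all_algebra.
From mathcomp Require Import all_classical all_reals all_analysis.
From mathcomp Require Import measurable_realfun ess_sup_inf.

Set Implicit Arguments.
Unset Strict Implicit.
Unset Printing Implicit Defensive.

Import Order.TTheory GRing.Theory Num.Theory.
Import numFieldNormedType.Exports.

Local Open Scope classical_set_scope.
Local Open Scope ring_scope.

Section lebesgue_tuple_step.
Context {R : realType} (n : nat).
Variable mu : {sigma_finite_measure set (n.-tuple (measurableTypeR R)) -> \bar R}.

Definition cons_pair (p : measurableTypeR R * n.-tuple (measurableTypeR R)) :
  n.+1.-tuple (measurableTypeR R) := [the n.+1.-tuple _ of p.1 :: p.2].

Lemma measurable_cons_pair : measurable_fun [set: _] cons_pair.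
Proof. exact: measurable_cons. Qed.

Definition lebesgue_cons :=
  pushforward (@lebesgue_measure R \x mu)%E cons_pair.

HB.instance Definition _ := Measure.copy lebesgue_cons
  (measure_function_pushforward__canonical__measure_function_Measure
     (@lebesgue_measure R \x mu)%E measurable_cons_pair).

Let split_pair (t : n.+1.-tuple (measurableTypeR R)) :
    measurableTypeR R * n.-tuple (measurableTypeR R) :=
  (thead t, [tuple of behead t]).

Let measurable_split_pair : measurable_fun [set: _] split_pair.
Proof.
apply/measurable_fun_pair => /=; last exact: measurable_behead.
exact: measurable_tnth.
Qed.

Let cons_pairK : cancel cons_pair split_pair.
Proof.
by move=> [x t]; rewrite /split_pair /cons_pair /=; congr pair; apply/val_inj.
Qed.

Lemma lebesgue_cons_sigma_finite : sigma_finite setT lebesgue_cons.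
Proof.
have /sigma_finiteP[F [TF ndF Foo]] := sigma_finiteT (@lebesgue_measure R).
have /sigma_finiteP[G [TG ndG Goo]] := sigma_finiteT mu.
exists (fun k => split_pair @^-1` (F k `*` G k)).
  rewrite -preimage_bigcup (_ : \bigcup_i _ = setT) ?preimage_setT//.
  rewrite -setXTT TF TG predeqE => -[x y]; split.
    move=> [k _ []/= ? ?]; split; by exists k.
  move=> [/= [n' _ Fnx] [k _ Gky]]; exists (maxn n' k) => //; split.
  - by move: x Fnx; exact/subsetPset/ndF/leq_maxl.
  - by move: y Gky; exact/subsetPset/ndG/leq_maxr.
move=> k; have [? ?] := Foo k; have [? ?] := Goo k; split.
  rewrite -[X in measurable X]setTI; apply: measurable_split_pair => //.
  exact: measurableX.
rewrite /lebesgue_cons /pushforward -comp_preimage.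
rewrite (_ : _ \o _ = id); last by apply/funext => x/=; rewrite cons_pairK.
by rewrite preimage_id product_measure1E// lte_mul_pinfty// ge0_fin_numE.
Qed.

HB.instance Definition _ :=
  Measure_isSigmaFinite.Build _ _ _ lebesgue_cons lebesgue_cons_sigma_finite.

End lebesgue_tuple_step.

(* Built one coordinate at a time, as the n-fold product of the measure on R. *)
Fixpoint lebesgue_tuple (R : realType) (n : nat) :
    {sigma_finite_measure set (n.-tuple (measurableTypeR R)) -> \bar R} :=
  match n with
  | 0%N => dirac [tuple]
  | m.+1 => lebesgue_cons (lebesgue_tuple R m)
  end.

Lemma measurable_tuple_box (R : realType) (n : nat)
    (B : 'I_n -> set (measurableTypeR R)) : (forall i, measurable (B i)) ->
  measurable [set t : n.-tuple (measurableTypeR R) | forall i, B i (tnth t i)].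
Proof.
move=> mB; rewrite (_ : mkset _ = \bigcap_(i in [set: 'I_n])
    ((@tnth n (measurableTypeR R) ^~ i) @^-1` B i)); last first.
  by apply/seteqP; split => t /= Bt i; [move=> _; exact: Bt|exact: Bt].
apply: fin_bigcap_measurable => // i _.
by rewrite -[X in measurable X]setTI; exact: measurable_tnth.
Qed.

Lemma lebesgue_tuple_box (R : realType) (n : nat)
    (B : 'I_n -> set (measurableTypeR R)) : (forall i, measurable (B i)) ->
  lebesgue_tuple R n [set t | forall i, B i (tnth t i)] =
  (\prod_(i < n) lebesgue_measure (B i))%E.
Proof.
elim: n B => [|n IHn] B mB.
  by rewrite big_ord0 /= diracE mem_set// => -[].
rewrite big_ord_recl -IHn//= /lebesgue_cons /pushforward.
rewrite -product_measure1E; [|exact: mB|]; last first.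
  exact: (measurable_tuple_box (fun i => mB (lift ord0 i))).
congr (_ \x _)%E; apply/seteqP; split => -[x t] /=.
  move=> Bt; split=> [|i]; first by have := Bt ord0; rewrite tnth0.
  by have := Bt (lift ord0 i); rewrite tnthS.
move=> [Bx Bt] i; case: (unliftP ord0 i) => [j ->|->]; last by rewrite tnth0.
by rewrite tnthS.
Qed.

(* 'rV[R]_d with its Borel sigma-algebra. *)
Definition euclid (R : realType) (d : nat) : Type :=
  g_sigma_algebraType (@open 'rV[R]_d).

HB.instance Definition _ (R : realType) (d : nat) :=
  Measurable.on (euclid R d).

Section lebesgue_euclid.
Context {R : realType} (d : nat).

Definition row_of_tuple (t : d.-tuple (measurableTypeR R)) : euclid R d :=
  (\row_i (tnth t i : R) : 'rV[R]_d).

Let rbox (q : {ffun 'I_d -> rat}) (k : nat) : set 'rV[R]_d :=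
  [set x | forall i, `|ratr (q i) - x ord0 i| < k.+1%:R^-1].

Let open_rboxE (O : set 'rV[R]_d) : open O ->
  O = \bigcup_(p in [set p | rbox p.1 p.2 `<=` O]) rbox p.1 p.2.
Proof.
move=> oO; apply/seteqP; split => [x Ox|x [p pO]]; last exact: pO.
have [e /= e0 eO] : exists2 e : R, 0 < e & ball x e `<=` O.
  by move: oO; rewrite openE => /(_ _ Ox) /nbhs_ballP[e e0 eO]; exists e.
have [k ke] : exists k : nat, k.+1%:R^-1 < e / 2.
  have [k _ H] := near_infty_natSinv_lt (PosNum (divr_gt0 e0 (ltr0n R 2))).
  by exists k; exact: (H k (leqnn k)).
have qP (i : 'I_d) : exists q : rat, `|ratr q - x ord0 i| < k.+1%:R^-1.
  have : x ord0 i - k.+1%:R^-1 < x ord0 i + k.+1%:R^-1.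
    by rewrite ltrD2l gtrN// invr_gt0.
  move=> /rat_in_itvoo[q]; rewrite in_itv/= => qx; exists q.
  by rewrite ltr_distl.
have [q {}qP] := choice qP.
exists ([ffun i => q i], k) => /= [y|]; last by move=> i; rewrite ffunE.
move=> yq; apply: eO; split => // i j; rewrite ord1 /ball/=.
rewrite -(subrK (ratr (q j)) (x ord0 j)) -addrA (le_lt_trans (ler_normD _ _))//.
rewrite (splitr e) ltrD// (lt_trans _ ke)//; first by rewrite distrC.
by have := yq j; rewrite ffunE.
Qed.

Lemma measurable_row_of_tuple : measurable_fun [set: _] row_of_tuple.
Proof.
apply: (@measurability _ _ _ _ _ row_of_tuple (@open 'rV[R]_d)) => //.
move=> _ [V oV <-]; rewrite setTI (open_rboxE oV) preimage_bigcup.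
rewrite bigcup_mkcond; apply: countable_bigcupT_measurable => // p.
case: ifPn => // _.
rewrite (_ : _ @^-1` _ = [set t | forall i,
    [set y : measurableTypeR R | `|ratr (p.1 i) - y| < p.2.+1%:R^-1]
      (tnth t i)]).
  apply: (@measurable_tuple_box _ _ (fun i => [set y : measurableTypeR R |
    `|ratr (p.1 i) - y| < p.2.+1%:R^-1])) => i.
  rewrite (_ : [set _ | _] = ball (ratr (p.1 i) : R) p.2.+1%:R^-1)//.
  by rewrite ball_itv; exact: measurable_itv.
by apply/seteqP; split => t /= Bt i; have := Bt i; rewrite mxE.
Qed.

Definition lebesgue_euclid : {measure set (euclid R d) -> \bar R} :=
  measure_function_pushforward__canonical__measure_function_Measure
    (lebesgue_tuple R d) measurable_row_of_tuple.

Lemma lebesgue_euclid_box (B : 'I_d -> set (measurableTypeR R)) :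
  (forall i, measurable (B i)) ->
  lebesgue_euclid [set x : 'rV[R]_d | forall i, B i (x ord0 i)] =
  (\prod_(i < d) lebesgue_measure (B i))%E.
Proof.
move=> mB; rewrite -lebesgue_tuple_box//.
congr (lebesgue_tuple _ _ _); apply/seteqP.
by split => t /= Bt i; have := Bt i; rewrite mxE.
Qed.

End lebesgue_euclid.

Lemma ae_eq_LnormE d (T : measurableType d) (R : realType)
    (mu : {measure set T -> \bar R}) (p : \bar R) (f g : {mfun T >-> R}) :
  (1 <= p)%E -> f = g %[ae mu] ->
  ('N[mu]_p[EFin \o f] = 'N[mu]_p[EFin \o g])%E.
Proof.
rewrite unlock; case: p => [r r1|_|]// fg; last first.
  case: ifPn => // _; apply: eq_ess_sup.
  by apply: filterS fg => x /(_ I) /= ->.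
have mr (h : {mfun T >-> R}) :
    measurable_fun [set: T] (fun x => (`|h x| `^ r)%:E).
  apply/measurable_EFinP.
  apply: (@measurableT_comp _ _ _ _ _ _ (@powR R ^~ r)) => //.
  exact: measurableT_comp.
congr (_ `^ _)%E.
rewrite (_ : (fun x => _) = fun x => (`|f x| `^ r)%:E)//.
rewrite [in RHS](_ : (fun x => _) = fun x => (`|g x| `^ r)%:E)//.
apply: ae_eq_integral => //.
by apply: filterS fg => x /(_ I) /= -> .
Qed.

(* The library's [LspaceType] carries no algebraic structure, whence this
   quotient of [LfunType] by equality almost everywhere. *)
Section Lp.
Context {d} {T : measurableType d} {R : realType}.
Variables (mu : {measure set T -> \bar R}) (p : \bar R) (p1 : (1 <= p)%E).
Implicit Types f g : LfunType mu p1.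

Definition Lp_eq f g : bool := `[< f = g %[ae mu] >].

Let Lp_eq_refl : reflexive Lp_eq.
Proof. by move=> f; apply/asboolP/nearW. Qed.

Let Lp_eq_sym : symmetric Lp_eq.
Proof. by move=> f g; apply/idP/idP => /asboolP h; apply/asboolP/ae_eq_sym. Qed.

Let Lp_eq_trans : transitive Lp_eq.
Proof.
by move=> f g h /asboolP gf /asboolP fh; apply/asboolP/(ae_eq_trans gf fh).
Qed.

Canonical Lp_equiv := EquivRel Lp_eq Lp_eq_refl Lp_eq_sym Lp_eq_trans.

Local Open Scope quotient_scope.

Definition Lp : Type := {eq_quot Lp_eq}.
HB.instance Definition _ := Choice.on Lp.
HB.instance Definition _ := EqQuotient.on Lp.

Definition Lp_repr (v : Lp) : LfunType mu p1 := repr v.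
Definition fun_of_Lp (v : Lp) : T -> R := Lp_repr v.
Definition Lp_pi f : Lp := \pi_Lp f.

Lemma Lp_piP f g : Lp_pi f = Lp_pi g <-> f = g %[ae mu].
Proof.
by split => [/eqP|fg]; [rewrite eqmodE => /asboolP|
                        apply/eqP; rewrite eqmodE; exact/asboolP].
Qed.

Lemma Lp_piK f : fun_of_Lp (Lp_pi f) = f %[ae mu].
Proof. by apply/Lp_piP; rewrite /Lp_pi /Lp_repr reprK. Qed.

Lemma Lp_reprK (v : Lp) : Lp_pi (Lp_repr v) = v.
Proof. exact: reprK. Qed.

Let add (v w : Lp) : Lp := Lp_pi (Lp_repr v + Lp_repr w).
Let opp (v : Lp) : Lp := Lp_pi (- Lp_repr v).
Let scale (a : R) (v : Lp) : Lp := Lp_pi (a *: Lp_repr v).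
Let nm (v : Lp) : R := fine ('N[mu]_p[EFin \o fun_of_Lp v]).

Let LfunD f g x : (f + g) x = f x + g x. Proof. by []. Qed.
Let LfunN f x : (- f) x = - f x. Proof. by []. Qed.
Let LfunZ a f x : (a *: f) x = a * f x. Proof. by []. Qed.

Let addE f g : add (Lp_pi f) (Lp_pi g) = Lp_pi (f + g).
Proof.
apply/Lp_piP; apply: filterS2 (Lp_piK f) (Lp_piK g) => x /(_ I) fx /(_ I) gx _.
by rewrite !LfunD [Lp_repr _ x]fx [Lp_repr _ x]gx.
Qed.

Let oppE f : opp (Lp_pi f) = Lp_pi (- f).
Proof.
apply/Lp_piP; apply: filterS (Lp_piK f) => x /(_ I) fx _.
by rewrite !LfunN [Lp_repr _ x]fx.
Qed.

Let scaleE a f : scale a (Lp_pi f) = Lp_pi (a *: f).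
Proof.
apply/Lp_piP; apply: filterS (Lp_piK f) => x /(_ I) fx _.
by rewrite !LfunZ [Lp_repr _ x]fx.
Qed.

Let addA : associative add.
Proof.
move=> u v w; rewrite -(Lp_reprK u) -(Lp_reprK v) -(Lp_reprK w).
by rewrite !addE addrA.
Qed.

Let addC : commutative add.
Proof. by move=> u v; rewrite /add addrC. Qed.

Let add0 : left_id (Lp_pi 0) add.
Proof. by move=> u; rewrite -(Lp_reprK u) addE add0r. Qed.

Let addN : left_inverse (Lp_pi 0) opp add.
Proof. by move=> u; rewrite -(Lp_reprK u) oppE addE addNr. Qed.

HB.instance Definition _ := GRing.isZmodule.Build Lp addA addC add0 addN.

Let scaleA a b v : scale a (scale b v) = scale (a * b) v.
Proof. by rewrite -(Lp_reprK v) !scaleE scalerA. Qed.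

Let scale1 : left_id 1 scale.
Proof. by move=> v; rewrite -(Lp_reprK v) scaleE scale1r. Qed.

Let scaleDr : right_distributive scale +%R.
Proof.
move=> a u v; rewrite -(Lp_reprK u) -(Lp_reprK v).
by rewrite [LHS](congr1 (scale a) (addE _ _)) !scaleE scalerDr; exact/esym/addE.
Qed.

Let scaleDl v : {morph scale^~ v : a b / a + b}.
Proof.
move=> a b; rewrite -(Lp_reprK v) !scaleE scalerDl; exact/esym/addE.
Qed.

HB.instance Definition _ :=
  GRing.Zmodule_isLmodule.Build R Lp scaleA scale1 scaleDr scaleDl.

Lemma Lp_piD f g : Lp_pi (f + g) = Lp_pi f + Lp_pi g.
Proof. exact/esym/addE. Qed.

Lemma Lp_piZ a f : Lp_pi (a *: f) = a *: Lp_pi f.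
Proof. exact/esym/scaleE. Qed.

Lemma Lp_piN f : Lp_pi (- f) = - Lp_pi f.
Proof. exact/esym/oppE. Qed.

Let nmE f : nm (Lp_pi f) = fine ('N[mu]_p[EFin \o f]).
Proof. by congr fine; exact/ae_eq_LnormE/Lp_piK. Qed.

Let nmD u v : nm (u + v) <= nm u + nm v.
Proof.
rewrite -(Lp_reprK u) -(Lp_reprK v) -Lp_piD !nmE; exact: ler_LnormD.
Qed.

Let nmZ a v : nm (a *: v) = `|a| * nm v.
Proof.
rewrite -(Lp_reprK v) -Lp_piZ !nmE.
apply/EFin_inj; rewrite EFinM !finite_norm_fine; exact: LnormZ.
Qed.

Let nm0_eq0 v : nm v = 0 -> v = 0.
Proof.
rewrite -(Lp_reprK v) nmE => /fine_Lnormr_eq0 v0.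
by apply/Lp_piP.
Qed.

HB.instance Definition _ := Lmodule_isNormed.Build R Lp nmD nmZ nm0_eq0.

Lemma Lp_normE f : `|Lp_pi f| = fine ('N[mu]_p[EFin \o f]).
Proof. exact: nmE. Qed.

End Lp.
Coercion fun_of_Lp : Lp >-> Funclass.

Section Lp_incl.
Context {d} {T : measurableType d} {R : realType}.
Variables (mu : {measure set T -> \bar R}) (p q : \bar R).
Variables (p1 : (1 <= p)%E) (q1 : (1 <= q)%E).
Hypotheses (mufin : mu [set: T] \is a fin_num) (pq : (p <= q)%E).

Definition Lp_incl (w : Lp mu q1) : Lp mu p1 :=
  Lp_pi (Lfun_Sub p1 (Lfun_subset p1 q1 mufin pq (LfunP (Lp_repr w)))).

Lemma Lp_inclE (w : Lp mu q1) : fun_of_Lp (Lp_incl w) = w %[ae mu].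
Proof. exact: Lp_piK. Qed.

End Lp_incl.

(* The library's norm on 'rV[R]_d is the sup norm; balls and diameters below are
   Euclidean. *)
Definition enorm (R : realType) (d : nat) (x : 'rV[R]_d) : R :=
  Num.sqrt (\sum_(i < d) x ord0 i ^+ 2).

(* Near each boundary point, after a rotation [Q], the set is the strict
   epigraph, in the i-th coordinate, of a Lipschitz function of the others. *)
Definition lipschitz_boundary (R : realType) (d : nat) (D : set 'rV[R]_d) :=
  forall x, closure D x -> ~ D x ->
  exists (r : R) (Q : 'M[R]_d) (i : 'I_d) (g : 'rV[R]_d.-1 -> R),
    [/\ 0 < r, Q *m Q^T = 1%:M,
        exists L, forall y z, `|g y - g z| <= L * enorm (y - z) &
        forall y, enorm (y - x) < r ->
          (D y <-> g (col' i (y *m Q)) < (y *m Q) ord0 i)].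

Record lipschitz_domain (R : realType) (d : nat) := LipschitzDomain {
  domain_set :> set 'rV[R]_d ;
  domain_nonempty : domain_set !=set0 ;
  domain_open : open domain_set ;
  domain_connected : connected domain_set ;
  domain_bounded : bounded_set domain_set ;
  domain_lipschitz : lipschitz_boundary domain_set }.

Section lebesgue_on.
Context {R : realType} {d : nat} (Omega : lipschitz_domain R d).

Lemma measurable_domain : measurable (Omega : set (euclid R d)).
Proof. by apply: sub_sigma_algebra; exact: domain_open. Qed.

Definition lebesgue_on : {measure set (euclid R d) -> \bar R} :=
  mrestr (lebesgue_euclid d) measurable_domain.

Lemma lebesgue_on_fin : lebesgue_on [set: _] \is a fin_num.
Proof.
rewrite ge0_fin_numE ?measure_ge0//.
have [M [_ /(_ (M + 1))]] := domain_bounded Omega.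
rewrite ltrDl ltr01 => /(_ isT) OM.
pose B (_ : 'I_d) : set (measurableTypeR R) := `[- (M + 1), M + 1]%classic.
have mB i : measurable (B i) by exact: measurable_itv.
apply: (@le_lt_trans _ _ (\prod_(i < d) lebesgue_measure (B i))%E); last first.
  rewrite ltey_eq; apply/orP; left; apply: prode_fin_num => i _.
  by rewrite /B lebesgue_measure_itv/=; case: ifPn.
rewrite -lebesgue_euclid_box// /lebesgue_on /= /mrestr setTI.
have BE : [set x : 'rV[R]_d | forall i, B i (x ord0 i)] =
    [set x : 'rV[R]_d | `|x| <= M + 1].
  have M0 : 0 <= M + 1.
    by have [x /OM /= xM] := domain_nonempty Omega; exact: le_trans xM.
  have normE (x : 'rV[R]_d) : `|x| = \big[Num.max/0]_ij `|x ij.1 ij.2|.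
    by rewrite -mx_normrE.
  apply/seteqP; split => x /=; rewrite normE.
    move=> Bx; apply: bigmax_le => // -[i j] _ /=; rewrite ord1.
    by rewrite ler_norml; have := Bx j; rewrite /B /= in_itv.
  move=> xM i; rewrite /B /= in_itv /= -ler_norml (le_trans _ xM)//.
  exact: (le_bigmax _ (fun ij => `|x ij.1 ij.2|) (ord0, i)).
have mBd : measurable ([set x | `|x| <= M + 1] : set (euclid R d)).
  rewrite -[X in measurable X]setCK; apply: measurableC; apply: sub_sigma_algebra.
  rewrite (_ : ~` _ = Num.norm @^-1` [set y | M + 1 < y]).
    apply: open_comp => [x _|]; [exact: norm_continuous|exact: open_gt].
  by apply/seteqP; split => x /=; rewrite ltNge => /negP.
apply: le_measure; last by rewrite BE => x /OM.
- exact: measurable_row_of_tuple.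
- by rewrite inE; exact: measurable_domain.
- by rewrite inE BE.
Qed.

End lebesgue_on.

(* Measurable functions are taken on the whole of R^d, but only their values on
   Omega matter for equality in, and the norm of, these spaces. *)
Notation L2 Omega := (Lp (lebesgue_on Omega) (lee1n 2)).
Notation Linf Omega := (Lp (lebesgue_on Omega) (leey 1)).

Definition Linf_L2 (R : realType) (d : nat) (Omega : lipschitz_domain R d) :
    Linf Omega -> L2 Omega :=
  Lp_incl (lee1n 2) (lebesgue_on_fin Omega) (leey 2%:E).

Definition bounded_operator (R : realType) (V W : normedModType R) (f : V -> W) :=
  exists M : R, forall v, `|f v| <= M * `|v|.

Definition continuous_embedding (R : realType) (V W : normedModType R)
    (f : V -> W) := injective f /\ bounded_operator f.

(* Isomorphism of normed spaces: the inverse is bounded as well. *)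
Definition isomorphism (R : realType) (V W : normedModType R) (f : V -> W) :=
  bounded_operator f /\
  exists g : W -> V, [/\ cancel f g, cancel g f & bounded_operator g].

Definition finite_dimensional (R : realType) (V : lmodType R) (S : set V) :=
  exists (n : nat) (phi : 'I_n -> V),
    S = [set v | exists c : 'I_n -> R, v = \sum_(i < n) c i *: phi i].

Definition conv_hull (R : realType) (V : lmodType R) (S : set V) : set V :=
  [set v | exists (n : nat) (a : 'I_n -> R) (s : 'I_n -> V),
    [/\ forall i, 0 <= a i, \sum_(i < n) a i = 1, forall i, S (s i) &
        v = \sum_(i < n) a i *: s i]].

(* Set-valued, since S need be neither closed nor convex. *)
Definition metric_projection (R : realType) (V : normedModType R) (S : set V)
    (v : V) : set V :=
  [set s | S s /\ forall s', S s' -> `|v - s| <= `|v - s'|].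

Definition optimal_value (R : realType) (X : Type) (F : set X) (J : X -> R) :
  \bar R := ereal_inf [set (J x)%:E | x in F].

Definition argmin (R : realType) (X : Type) (F : set X) (J : X -> R) : set X :=
  [set x | F x /\ forall y, F y -> J x <= J y].

Definition diameter (R : realType) (d : nat) (D : set 'rV[R]_d) : R :=
  sup [set enorm (x - y) | x in D & y in D].

Definition mesh (R : realType) (d : nat) (Omega : lipschitz_domain R d)
    (N : nat) (Q : 'I_N -> set (euclid R d)) (size : R) :=
  [/\ forall i, measurable (Q i),
      forall i, (0 < lebesgue_euclid d (Q i))%E,
      trivIset setT Q,
      \bigcup_i Q i = Omega &
      \big[Num.max/0]_(i < N) diameter (Q i) = size].

Definition local_average (R : realType) (d : nat) (N : nat)
    (Q : 'I_N -> set (euclid R d)) (v : euclid R d -> R) : euclid R d -> R :=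
  fun x => \sum_(i < N) \1_(Q i) x *
    ((fine (lebesgue_euclid d (Q i)))^-1 * \int[lebesgue_euclid d]_(y in Q i) v y).

Section problems.
Context {R : realType} {d : nat} {Omega : lipschitz_domain R d}.
Context {U Y : completeNormedModType R}.
(* [iota] is the embedding of U into L^2. *)
Variables (iota A : U -> L2 Omega) (T : L2 Omega -> Y).
Variables (f0 : Linf Omega) (f1 : L2 Omega).
Local Notation mu := (lebesgue_on Omega).

Definition state_eq (u : U) (w : euclid R d -> R) :=
  \forall x \ae mu, A u x + f0 x * iota u x * w x = f1 x.

Section averaged.
Context {N : nat} (Q : 'I_N -> set (euclid R d)).
Local Notation P := (local_average Q).

Definition averaged_state_eq (u : U) (w : euclid R d -> R) :=
  \forall x \ae mu, A u x + f0 x * P (iota u) x * P w x = f1 x.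

Definition mccormick_ineqs (ul uu wl wu : 'I_N -> R)
    (u w z : euclid R d -> R) :=
  forall i, exists2 zi : R, (\forall x \ae mu, Q i x -> z x = zi) &
    \forall x \ae mu, Q i x ->
      [/\ ul i * P w x + wl i * P u x - ul i * wl i - zi <= 0,
          uu i * P w x + wu i * P u x - uu i * wu i - zi <= 0,
          zi - uu i * P w x - wl i * P u x + uu i * wl i <= 0 &
          zi - ul i * P w x - wu i * P u x + ul i * wu i <= 0].

Definition feasible_McC (Wadh Zadtau : set (Linf Omega))
    (ul uu wl wu : 'I_N -> R) : set (U * Linf Omega * Linf Omega) :=
  [set uwz : U * Linf Omega * Linf Omega | let: (u, w, z) := uwz in
    [/\ \forall x \ae mu, A u x + f0 x * z x = f1 x,
        conv_hull Wadh w, Zadtau z & mccormick_ineqs ul uu wl wu (iota u) w z]].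

Definition objective_McC (y : Y) (uwz : U * Linf Omega * Linf Omega) : R :=
  `|T (iota uwz.1.1) - y|.

End averaged.

Definition feasible_I (Wad : set (Linf Omega)) : set (U * Linf Omega) :=
  [set uw : U * Linf Omega | state_eq uw.1 uw.2 /\ Wad uw.2].

Definition objective_I (y : Y) (uw : U * Linf Omega) : R :=
  `|T (iota uw.1) - y|.

End problems.

Section assumptions.
Context {R : realType} {d : nat} {Omega : lipschitz_domain R d}.
Context {U : completeNormedModType R}.
Variables (iota A : U -> L2 Omega) (f0 : Linf Omega) (f1 : L2 Omega).
Variables (Wad : set (Linf Omega)) (Vh : set (L2 Omega)).
Variables (Zad Zadtau : set (Linf Omega)).
Context {N : nat}.
Variables (Q : 'I_N -> set (euclid R d)) (ul uu wl wu : 'I_N -> R).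
Local Notation mu := (lebesgue_on Omega).
Local Notation P := (local_average Q).
Local Notation E := (state_eq iota A f0 f1).
Local Notation Etau := (averaged_state_eq iota A f0 f1 Q).

Definition discrete_Wad : set (Linf Omega) :=
  Wad `&` @Linf_L2 R d Omega @^-1` Vh.
Local Notation Wadh := discrete_Wad.

Record structural_assumptions : Prop := StructuralAssumptions {
  (* nonemptiness is implicit in the use of the metric projection onto Vh *)
  Vh_closed_convex : [/\ Vh !=set0, closed Vh, convex_set Vh &
        exists2 S : set (L2 Omega), finite_dimensional S & Vh `<=` S] ;
  unique_states : forall w, Wad w -> (exists! u, E u w) /\ (exists! u, Etau u w) ;
  state_bounds : exists u_l u_u : Linf Omega, forall w u, Wad w -> E u w ->
        \forall x \ae mu, u_l x <= iota u x <= u_u x ;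
  averaged_state_bounds : forall w u, Wad w -> Etau u w ->
        forall i, \forall x \ae mu, Q i x -> ul i <= P (iota u) x <= uu i ;
  averaged_coefficient_bounds : forall w, Wadh w ->
        forall i, \forall x \ae mu, Q i x -> wl i <= P w x <= wu i ;
  projection_Vh_Wadh : forall w, Wad w -> metric_projection Vh (Linf_L2 w) =
        metric_projection (@Linf_L2 R d Omega @` Wadh) (Linf_L2 w) ;
  Zad_products : [/\ closed Zad, convex_set Zad, bounded_set Zad &
        forall w u, Wadh w -> E u w ->
        exists2 z, Zad z & \forall x \ae mu, z x = iota u x * w x] ;
  Zadtau_products : [/\ closed Zadtau, convex_set Zadtau, bounded_set Zadtau,
        forall z, Zadtau z ->
          forall i, exists c : R, \forall x \ae mu, Q i x -> z x = c &
        forall w u, Wadh w -> Etau u w ->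
        exists2 z, Zadtau z & \forall x \ae mu, z x = P (iota u) x * P w x] }.

End assumptions.

(* Main.v *)
(* If (u, w) solves (I) and v is a metric projection of w onto Vh, then by (A6)
   v is the class of some wh in Wadh. With udt the averaged state for wh,
   (udt, wh, (P udt)(P wh)) is feasible for the McCormick problem, because the
   bilinear term satisfies its own relaxation. The triangle inequality through
   T u and ydag then bounds its objective by m_I + |T u - T udt| + delta. When
   (I) has no minimizer the infimum is +oo, and the bound is trivial. *)
Require Import Defs.
From HB Require Import structures.
From mathcomp Require Import all_boot all_order all_algebra.
From mathcomp Require Import all_classical all_reals all_analysis.
From mathcomp Require Import measurable_realfun lra.

Set Implicit Arguments.
Unset Strict Implicit.
Unset Printing Implicit Defensive.

Import Order.TTheory GRing.Theory Num.Theory.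
Import numFieldNormedType.Exports.

Local Open Scope classical_set_scope.
Local Open Scope ring_scope.

(* The library's hint for this does not fire on the canonical structures
   inferred for [lebesgue_on] and [lebesgue_euclid]. *)
#[local] Instance ae_euclid_filter (R : realType) (d : nat)
    (mu : {measure set (euclid R d) -> \bar R}) :
  Filter (almost_everywhere mu).
Proof. exact: ae_filter_ringOfSetsType. Qed.

Section domain_measure.
Context {R : realType} {d : nat} (Omega : lipschitz_domain R d).

(** The restricted measure of [B] is the Lebesgue measure of its part in [Omega], so cutting an
    exceptional set down to [Omega] makes it Lebesgue null. *)
Lemma ae_lebesgue_on (P : set (euclid R d)) :
  (\forall x \ae lebesgue_on Omega, P x) ->
  \forall x \ae lebesgue_euclid d, domain_set Omega x -> P x.
Proof.
move=> [B [mB B0 PB]]; exists (B `&` Omega); split => //.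
- by apply: measurableI => //; exact: measurable_domain.
- move=> x /= /not_implyP[Ox nPx]; split => //; exact: PB.
Qed.

(** The cells lie in [Omega] and integrals ignore null sets, so an average depends only on the class
    of the function. The two averages agree everywhere, not just almost everywhere. *)
Lemma eq_local_average (N : nat) (Q : 'I_N -> set (euclid R d)) (s : R)
    (f g : {mfun euclid R d >-> R}) :
  mesh Omega Q s -> f = g %[ae lebesgue_on Omega] ->
  local_average Q f = local_average Q g.
Proof.
move=> [mQ _ _ QO _] fg; apply/funext => x.
apply: eq_bigr => i _; congr (_ * (_ * fine _)).
apply: ae_eq_integral => //.
- by apply/measurable_EFinP; exact: measurable_funTS.
- by apply/measurable_EFinP; exact: measurable_funTS.
apply: filterS (ae_lebesgue_on fg) => y fgy Qy.
by rewrite fgy// -QO; exists i.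
Qed.

End domain_measure.

Lemma sub_conv_hull (R : realType) (V : lmodType R) (S : set V) :
  S `<=` conv_hull S.
Proof.
move=> v Sv; exists 1%N, (fun=> 1), (fun=> v).
by rewrite !big_ord1 scale1r; split.
Qed.

(** Up to sign, the left-hand sides are the nonnegative products [(u - ul) * (w - wl)],
    [(uu - u) * (wu - w)], [(uu - u) * (w - wl)] and [(u - ul) * (wu - w)]. *)
Lemma mccormick_relaxation (R : realDomainType) (ul uu wl wu u w : R) :
  ul <= u <= uu -> wl <= w <= wu ->
  [/\ ul * w + wl * u - ul * wl - u * w <= 0,
      uu * w + wu * u - uu * wu - u * w <= 0,
      u * w - uu * w - wl * u + uu * wl <= 0 &
      u * w - ul * w - wu * u + ul * wu <= 0].
Proof. by move=> /andP[? ?] /andP[? ?]; split; nra. Qed.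

Lemma le_optimal_value (R : realType) (X : Type) (F : set X) (J : X -> R) x :
  F x -> (optimal_value F J <= (J x)%:E)%E.
Proof. by move=> Fx; apply: ereal_inf_lbound; exists x. Qed.

Lemma optimal_value_argmin (R : realType) (X : Type) (F : set X) (J : X -> R) x :
  argmin F J x -> optimal_value F J = (J x)%:E.
Proof.
move=> [Fx Jx]; apply/eqP; rewrite eq_le le_optimal_value//=.
by apply: le_ereal_inf_tmp => _ [y Fy <-]; rewrite lee_fin Jx.
Qed.

Section averaged_states.
Context {R : realType} {d : nat} {Omega : lipschitz_domain R d}.
Context {U : completeNormedModType R}.
Variables (iota A : U -> L2 Omega) (f0 : Linf Omega) (f1 : L2 Omega).
Variables (Wad : set (Linf Omega)) (Vh : set (L2 Omega)).
Variables (Zad Zadtau : set (Linf Omega)).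
Variables (N : nat) (Q : 'I_N -> set (euclid R d)) (ul uu wl wu : 'I_N -> R).
Hypothesis SA : structural_assumptions iota A f0 f1 Wad Vh Zad Zadtau Q
  ul uu wl wu.

(** (A8) supplies [z] as the product of the two averages, while (A4) and (A5) bound its factors on
    each cell. *)
Lemma averaged_state_feasible_McC (w : Linf Omega) (u : U) :
  discrete_Wad Wad Vh w -> averaged_state_eq iota A f0 f1 Q u w ->
  exists z : Linf Omega, feasible_McC iota A f0 f1 Q (discrete_Wad Wad Vh)
    Zadtau ul uu wl wu (u, w, z).
Proof.
move=> Ww Euw; have [_ _ _ Zcst /(_ _ _ Ww Euw)[z Zz zE]] := Zadtau_products SA.
exists z; split => //; last 1 first.
- move=> i; have [c zc] := Zcst _ Zz i; exists c => //.
  have uB := averaged_state_bounds SA (proj1 Ww) Euw i.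
  have wB := averaged_coefficient_bounds SA Ww i.
  apply: filterS2 (filterI zc zE) (filterI uB wB) => x [zcx zEx] [uBx wBx] Qx.
  (* The cell constant [c] is the product of the averages at [x], which reduces the claim to real
     numbers. *)
  rewrite -(zcx Qx) zEx.
  exact: mccormick_relaxation (uBx Qx) (wBx Qx).
- apply: filterS2 Euw zE => x /= + ->; by rewrite mulrA.
- exact: sub_conv_hull.
Qed.

Lemma metric_projection_discrete_Wad (w : Linf Omega) (v : L2 Omega) :
  Wad w -> metric_projection Vh (Linf_L2 w) v ->
  exists2 wh, discrete_Wad Wad Vh wh & Linf_L2 wh = v.
Proof. by move=> Ww; rewrite (projection_Vh_Wadh SA Ww) => -[[wh]]; exists wh. Qed.

Lemma projected_state_feasible_McC (s : R) (w : Linf Omega) (v : L2 Omega)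
    (u : U) :
  mesh Omega Q s -> Wad w -> metric_projection Vh (Linf_L2 w) v ->
  averaged_state_eq iota A f0 f1 Q u v ->
  exists wh z : Linf Omega, feasible_McC iota A f0 f1 Q
    (discrete_Wad Wad Vh) Zadtau ul uu wl wu (u, wh, z).
Proof.
move=> QP Ww /(metric_projection_discrete_Wad Ww)[wh Wwh <-] Eu; exists wh.
apply: averaged_state_feasible_McC => //.
(* [Eu] averages the representative in [L2], the goal the one in [Linf]; they agree only almost
   everywhere. *)
rewrite /averaged_state_eq -(@eq_local_average _ _ Omega _ _ s
  (Lp_repr (Linf_L2 wh)) (Lp_repr wh) QP) //.
exact: Lp_inclE.
Qed.

End averaged_states.

Theorem proposition4p3 (R : realType) (d : nat) (d_gt0 : (0 < d)%N)
    (Omega : lipschitz_domain R d) (U Y : completeNormedModType R)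
    (iota : {linear U -> L2 Omega}) (iotaP : continuous_embedding iota)
    (A : {linear U -> L2 Omega}) (AP : isomorphism A)
    (T : {linear L2 Omega -> Y}) (TP : bounded_operator T)
    (f0 : Linf Omega) (f0_ge0 : \forall x \ae lebesgue_on Omega, 0 <= f0 x)
    (f1 : L2 Omega)
    (w_l w_u : Linf Omega) (Wad : set (Linf Omega)) (Wad_neq0 : Wad !=set0)
    (Wad_bnd : forall w, Wad w ->
       \forall x \ae lebesgue_on Omega, w_l x <= w x <= w_u x)
    (delta : R) (delta_gt0 : 0 < delta) (ydag ydelta : Y)
    (noise : `|ydag - ydelta| <= delta)
    (h : R -> R) (h_gt0 : 0 < h delta) (tau : R) (tau_gt0 : 0 < tau)
    (Nh : nat) (Qh : 'I_Nh -> set (euclid R d)) (QhP : mesh Omega Qh (h delta))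
    (Ntau : nat) (Qtau : 'I_Ntau -> set (euclid R d))
    (QtauP : mesh Omega Qtau tau)
    (Vh : set (L2 Omega)) (Zad Zadtau : set (Linf Omega))
    (ul uu wl wu : 'I_Ntau -> R)
    (SA : structural_assumptions iota A f0 f1 Wad Vh Zad Zadtau Qtau
            ul uu wl wu)
    (m_I := optimal_value (feasible_I iota A f0 f1 Wad)
              (objective_I iota T ydag))
    (m_McC := optimal_value
                (feasible_McC iota A f0 f1 Qtau (discrete_Wad Wad Vh) Zadtau
                   ul uu wl wu)
                (objective_McC iota T ydelta))
    (gap := ereal_inf [set r : \bar R |
       exists (u : U) (w : Linf Omega) (Phw : L2 Omega) (udt : U),
         [/\ argmin (feasible_I iota A f0 f1 Wad) (objective_I iota T ydag)
               (u, w),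
             metric_projection Vh (Linf_L2 w) Phw,
             averaged_state_eq iota A f0 f1 Qtau udt Phw &
             r = `|T (iota u) - T (iota udt)|%:E]]) :
  (m_McC - (gap + delta%:E) <= m_I)%E.
Proof.
have bound (u : U) (w : Linf Omega) (Phw : L2 Omega) (udt : U) :
    argmin (feasible_I iota A f0 f1 Wad) (objective_I iota T ydag) (u, w) ->
    metric_projection Vh (Linf_L2 w) Phw ->
    averaged_state_eq iota A f0 f1 Qtau udt Phw ->
    (m_McC <= m_I + `|T (iota u) - T (iota udt)|%:E + delta%:E)%E.
  move=> uw wP Eudt; have [[_ Ww] _] := uw.
  have [wh [z F]] := projected_state_feasible_McC SA QtauP Ww wP Eudt.
  rewrite /m_McC /m_I (optimal_value_argmin uw).
  apply: (le_trans (le_optimal_value _ F)).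
  rewrite lee_fin /objective_McC /objective_I /=.
  (* With [delta] replaced by the actual noise, the detour through [ydag] cancels it exactly. *)
  apply: le_trans (lerD (lexx _) noise).
  apply: (le_trans (ler_distD ydag _ _)); rewrite lerD2r addrC.
  by rewrite (distrC (T (iota u))); exact: ler_distD.
rewrite /gap; set S := (X in ereal_inf X).
have [->|/set0P[r0 Sr0]] := eqVneq S set0.
  (* Adding [-oo] to any extended real gives [-oo], so this covers an infinite [m_McC] too. *)
  by rewrite ereal_inf0 addye// addeNy leNye.
(* A member of [S] makes [m_I] and the infimum finite, so that both can be moved across inequalities
   in [\bar R]. *)
have [u0 [w0 [Phw0 [udt0 [uw0 _ _ r0E]]]]] := Sr0.
have m_IE := optimal_value_argmin uw0.
have inf_ge0 : (0 <= ereal_inf S)%E.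
  by apply: le_ereal_inf_tmp => _ [? [? [? [? [_ _ _ ->]]]]]; rewrite lee_fin.
have inf_fin : ereal_inf S \is a fin_num.
  rewrite ge0_fin_numE//; apply: (le_lt_trans (ereal_inf_lbound Sr0)).
  by rewrite r0E ltry.
have m_I_fin : m_I \is a fin_num by rewrite /m_I m_IE.
(* With the infimum isolated on the right, it remains to show that [m_McC - delta%:E - m_I] is a
   lower bound of [S]. *)
rewrite leeBlDr ?fin_numD ?inf_fin// addeA -leeBlDr// -leeBlDl//.
apply: le_ereal_inf_tmp => _ [u [w [Phw [udt [uw wP Eudt ->]]]]].
by rewrite leeBlDl// leeBlDr//; exact: bound uw wP Eudt.
Qed.
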